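(* Let $\mathcal{U}$ be a finite non-empty set of $n$ nodes of a directed graph in which every node has at least one outgoing edge, let $\mathcal{M}=\{\mathcal{D}_1,\dots,\mathcal{D}_K\}$ be a partition of $\mathcal{U}$ into non-empty blocks, and let $\mathbf{H}$, $\mathbf{M}=\mathbf{R}\mathbf{A}$ and $\mathbf{W}=\mathbf{A}\mathbf{R}$ be the associated hyperlink matrix, inter-level proximity matrix and indicator matrix. Let $\eta,\mu$ be positive real numbers with $\eta+\mu=1$ and let $\mathbf{P}=\eta\mathbf{H}+\mu\mathbf{M}$. If $\mathbf{W}$ is irreducible, then the ranking vector produced by $\mathbf{P}$ is a well-defined distribution that assigns positive ranking to every node; that is, there is exactly one probability vector $\boldsymbol{\pi}\in\mathbb{R}^n$ with $\boldsymbol{\pi}^{\intercal}\mathbf{P}=\boldsymbol{\pi}^{\intercal}$, and every entry of $\boldsymbol{\pi}$ is strictly positive.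
   Context: The ranking vector produced by a stochastic matrix $\mathbf{P}$ is defined to be its stationary distribution, i.e. the probability vector $\boldsymbol{\pi}$ with $\boldsymbol{\pi}^{\intercal}\mathbf{P}=\boldsymbol{\pi}^{\intercal}$; it is well-defined when this distribution is unique. Irreducibility: a non-negative square matrix $\mathbf{T}$ is irreducible if for every pair of indices $i,j$ there is a positive integer $m=m(i,j)$ with $[\mathbf{T}^m]_{ij}>0$. Graph and hyperlink matrix: $\mathcal{U}=\{u_1,\dots,u_n\}$ is the node set of a directed graph. For a node $u$, $\mathcal{G}_u\subseteq\mathcal{U}$ is the set of nodes $v$ such that there is an edge from $u$ to $v$, and $d_u=|\mathcal{G}_u|$, assumed to be $\geq 1$ for every $u$. The hyperlink matrix $\mathbf{H}\in\mathbb{R}^{n\times n}$ has $[\mathbf{H}]_{uv}=1/d_u$ if $v\in\mathcal{G}_u$ and $0$ otherwise; it is row-stochastic. Decomposition: $\{\mathcal{D}_1,\dots,\mathcal{D}_K\}$ is a partition of $\mathcal{U}$ into non-empty sets (blocks), and $\mathcal{D}_{(u)}$ is the unique block containing $u$. The proximal set of $u$ is $\mathcal{M}_u=\bigcup_{w\in\{u\}\cup\mathcal{G}_u}\mathcal{D}_{(w)}$. One writes $\mathcal{D}_j\in\mathcal{M}_u$ when $\mathcal{D}_j$ is one of the blocks in this union, i.e. $\mathcal{D}_j=\mathcal{D}_{(w)}$ for some $w\in\{u\}\cup\mathcal{G}_u$, and $N_u$ is the number of different such blocks. Inter-level proximity matrix: $\mathbf{M}\in\mathbb{R}^{n\times n}$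 has $[\mathbf{M}]_{uv}=\frac{1}{N_u|\mathcal{D}_{(v)}|}$ if $v\in\mathcal{M}_u$ and $0$ otherwise. It factors as $\mathbf{M}=\mathbf{R}\mathbf{A}$, where $\mathbf{A}\in\mathbb{R}^{K\times n}$ has $[\mathbf{A}]_{kj}=1$ if $u_j\in\mathcal{D}_k$ and $0$ otherwise, and $\mathbf{R}\in\mathbb{R}^{n\times K}$ has $[\mathbf{R}]_{ij}=\frac{1}{N_{u_i}|\mathcal{D}_j|}$ if $\mathcal{D}_j\in\mathcal{M}_{u_i}$ and $0$ otherwise. Indicator matrix: $\mathbf{W}=\mathbf{A}\mathbf{R}\in\mathbb{R}^{K\times K}$. *)

(* Defs.v *)
From mathcomp Require Export all_boot all_order all_algebra.
From mathcomp Require Export reals.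

Set Implicit Arguments.
Unset Strict Implicit.
Unset Printing Implicit Defensive.

Import GRing.Theory Num.Theory.
Local Open Scope ring_scope.

(* Nodes are 'I_n and a directed graph is its edge relation e : rel 'I_n
   (loops allowed).  A decomposition is a labelled family of blocks
   D : 'I_K -> {set 'I_n}. *)

Definition out_nbrs (n : nat) (e : rel 'I_n) (u : 'I_n) : {set 'I_n} :=
  [set v | e u v].

Definition hyperlink_mx (R : realFieldType) (n : nat) (e : rel 'I_n)
    : 'M[R]_n :=
  \matrix_(u, v) (if v \in out_nbrs e u then #|out_nbrs e u|%:R^-1 else 0).

Definition blocks (n K : nat) (D : 'I_K -> {set 'I_n}) : {set {set 'I_n}} :=
  [set D k | k : 'I_K].

(* The set of blocks forgets repetitions in the family, hence the separate
   injectivity; non-emptiness of the blocks is part of [partition]. *)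
Definition decomposition (n K : nat) (D : 'I_K -> {set 'I_n}) : Prop :=
  injective D /\ partition (blocks D) [set: 'I_n].

Definition block_of (n K : nat) (D : 'I_K -> {set 'I_n}) (u : 'I_n)
    : {set 'I_n} :=
  pblock (blocks D) u.

Definition prox_set (n K : nat) (e : rel 'I_n) (D : 'I_K -> {set 'I_n})
    (u : 'I_n) : {set 'I_n} :=
  \bigcup_(w in u |: out_nbrs e u) block_of D w.

(* The distinct blocks making up the proximal set of u; their number is N_u. *)
Definition prox_blocks (n K : nat) (e : rel 'I_n) (D : 'I_K -> {set 'I_n})
    (u : 'I_n) : {set {set 'I_n}} :=
  [set block_of D w | w in u |: out_nbrs e u].

Definition prox_mx (R : realFieldType) (n K : nat) (e : rel 'I_n)
    (D : 'I_K -> {set 'I_n}) : 'M[R]_n :=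
  \matrix_(u, v) (if v \in prox_set e D u
                  then (#|prox_blocks e D u|%:R * #|block_of D v|%:R)^-1
                  else 0).

(* The two factors: prox_mx = factor_R *m factor_A. *)
Definition factor_A (R : realFieldType) (n K : nat) (D : 'I_K -> {set 'I_n})
    : 'M[R]_(K, n) :=
  \matrix_(k, j) (if j \in D k then 1 else 0).

Definition factor_R (R : realFieldType) (n K : nat) (e : rel 'I_n)
    (D : 'I_K -> {set 'I_n}) : 'M[R]_(n, K) :=
  \matrix_(i, j) (if D j \in prox_blocks e D i
                  then (#|prox_blocks e D i|%:R * #|D j|%:R)^-1
                  else 0).

Definition indicator_mx (R : realFieldType) (n K : nat) (e : rel 'I_n)
    (D : 'I_K -> {set 'I_n}) : 'M[R]_K :=
  factor_A R D *m factor_R R e D.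

(* Meant for entrywise non-negative T. *)
Definition irreducible_mx (R : realFieldType) (k : nat) (T : 'M[R]_k) : Prop :=
  forall i j : 'I_k, exists2 m : nat, (0 < m)%N & 0 < (T ^+ m) i j.

Definition prob_vector (R : realFieldType) (n : nat) (p : 'cV[R]_n) : Prop :=
  (forall u, 0 <= p u 0) /\ \sum_u p u 0 = 1.

Definition ranking_vector (R : realFieldType) (n : nat) (P : 'M[R]_n)
    (p : 'cV[R]_n) : Prop :=
  prob_vector p /\ p^T *m P = p^T.

(* Main.v *)
(** The rows of [P] sum to one, so [P - 1] is singular and [P] has a nonzero left
fixed vector [x]. Summing the entrywise bound [|x| <= |x| P] gives an equality of
totals, so [|x|] is fixed as well. When the support graph of [P] is strongly
connected, a nonzero non-negative fixed vector is positive everywhere, which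
yields existence and positivity. Applied to [|x| + x], where [x] is the difference
of two ranking vectors, it yields uniqueness, as [x] has total zero.

Strong connectivity uses only the [M] part of [P]: from a node of [D k] one step
reaches all of [D k], and if [W k l > 0] then some node of [D k] reaches all of
[D l] in one step. *)

Require Import Defs.
From mathcomp Require Import all_boot all_order all_algebra.
From mathcomp Require Import reals.

Local Open Scope ring_scope.
Import Order.TTheory GRing.Theory Num.Theory.

Set Implicit Arguments.
Unset Strict Implicit.
Unset Printing Implicit Defensive.

(** * Fixed rows of a stochastic matrix *)

Definition stochastic_mx (R : numDomainType) (n : nat) (P : 'M[R]_n) : Prop :=
  (forall u v, 0 <= P u v) /\ (forall u, \sum_v P u v = 1).

Definition support_rel (R : numDomainType) (n : nat) (P : 'M[R]_n) : rel 'I_n :=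
  fun u v => 0 < P u v.

Section StochasticMatrices.
Variables (R : realFieldType) (n : nat) (P : 'M[R]_n).
Hypothesis P_stoch : stochastic_mx P.

Lemma sum_mul_stochastic (x : 'rV[R]_n) :
  \sum_v (x *m P) 0 v = \sum_u x 0 u.
Proof.
case: P_stoch => _ P1.
under eq_bigr do rewrite mxE.
rewrite exchange_big; apply: eq_bigr => u _.
by rewrite -mulr_sumr P1 mulr1.
Qed.

Lemma fixed_normr (x : 'rV[R]_n) :
  x *m P = x -> map_mx Num.norm x *m P = map_mx Num.norm x.
Proof.
case: (P_stoch) => P0 _ xP; set y := map_mx Num.norm x.
have le_y v : 0 <= (y *m P) 0 v - y 0 v.
  rewrite subr_ge0 [y 0 v]mxE -{1}xP !mxE.
  apply: le_trans (ler_norm_sum _ _ _) _.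
  by apply: ler_sum => u _; rewrite normrM (ger0_norm (P0 _ _)) mxE.
have /eqP : \sum_v ((y *m P) 0 v - y 0 v) = 0.
  by rewrite sumrB sum_mul_stochastic subrr.
rewrite psumr_eq0 // => /allP eq_y.
apply/rowP => v; apply/eqP; rewrite -subr_eq0.
by apply: eq_y; rewrite mem_index_enum.
Qed.

Lemma exists_fixed_row : (0 < n)%N -> exists2 x : 'rV[R]_n, x != 0 & x *m P = x.
Proof.
case: (P_stoch) => _ P1 n_gt0.
have : kermx (P - 1%:M) != 0.
  (* If [P - 1] were invertible, cancelling it from its product with the all-ones column, which is
     zero, would make that column zero; this fails at the index supplied by [0 < n]. *)
  apply/negP; rewrite kermx_eq0 row_free_unit => uP.
  have : (P - 1%:M) *m (const_mx 1 : 'cV[R]_n) = 0.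
    rewrite mulmxBl mul1mx; apply/colP => u; rewrite !mxE.
    under eq_bigr do rewrite mxE mulr1.
    by rewrite P1 subrr.
  move/(congr1 (mulmx (invmx (P - 1%:M)))); rewrite mulKmx // mulmx0.
  by move/colP/(_ (Ordinal n_gt0))/eqP; rewrite !mxE oner_eq0.
case/rowV0Pn=> x /sub_kermxP xP x0; exists x => //.
by apply/eqP; rewrite -subr_eq0 -{2}[x]mulmx1 -mulmxBr xP.
Qed.

Hypothesis P_conn : forall u v, connect (support_rel P) u v.

(** Positivity spreads along edges: [y w] is a sum of non-negative terms, among them [y u * P u w].
    Induct along a path from a node where [y] is positive. *)
Lemma fixed_row_gt0 (y : 'rV[R]_n) :
  y *m P = y -> (forall u, 0 <= y 0 u) -> y != 0 -> forall v, 0 < y 0 v.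
Proof.
case: (P_stoch) => P0 _ yP y0 /rV0Pn[u yu] v.
have {yu} : 0 < y 0 u by rewrite lt0r yu y0.
case/connectP: (P_conn u v) => s + ->.
elim: s u => //= w s IHs u /andP[uw ws] yu; apply: IHs ws _.
rewrite -yP mxE (bigD1 u) //=; apply: ltr_pwDl; first exact: mulr_gt0.
by apply: sumr_ge0 => i _; apply: mulr_ge0.
Qed.

Lemma fixed_row_sum0 (x : 'rV[R]_n) : x *m P = x -> \sum_u x 0 u = 0 -> x = 0.
Proof.
move=> xP sx0; pose y := map_mx Num.norm x + x.
have yP : y *m P = y by rewrite mulmxDl fixed_normr // xP.
have yE u : y 0 u = `|x 0 u| + x 0 u by rewrite !mxE.
have y_ge0 u : 0 <= y 0 u by rewrite yE -lerBlDr sub0r -normrN ler_norm.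
(* If [y = 0] then [x = - |x|]. Otherwise [y] is positive everywhere, while [|x| + x] vanishes
   wherever [x] is negative. So [x] has constant sign, and its zero total forces it to vanish. *)
have x_sign : (forall u, 0 <= x 0 u) \/ (forall u, 0 <= - x 0 u).
  have [y0|y0] := eqVneq y 0; [right|left] => u.
    move/rowP/(_ u)/eqP: y0; rewrite yE mxE addr_eq0 => /eqP <-.
    exact: normr_ge0.
  have := fixed_row_gt0 yP y_ge0 y0 u; rewrite yE leNgt => yu.
  by apply/negP => xu; move: yu; rewrite ltr0_norm // addNr ltxx.
apply/rowP => u; rewrite mxE; apply/eqP.
case: x_sign => x_ge0.
  move/eqP: sx0; rewrite psumr_eq0 // => /allP /(_ u).
  by rewrite mem_index_enum; apply.
have /eqP : \sum_u - x 0 u = 0 by rewrite sumrN sx0 oppr0.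
rewrite psumr_eq0 // => /allP /(_ u); rewrite mem_index_enum oppr_eq0.
by apply.
Qed.

Lemma ranking_vector_gt0 (p : 'cV[R]_n) :
  ranking_vector P p -> forall u, 0 < p u 0.
Proof.
case=> -[p_ge0 sp1] pP u.
have -> : p u 0 = p^T 0 u by rewrite mxE.
apply: (fixed_row_gt0 pP) => [v|]; first by rewrite mxE.
apply/eqP => /rowP p0; move/eqP: sp1; rewrite big1 => [|v _].
  by rewrite eq_sym oner_eq0.
by have := p0 v; rewrite !mxE.
Qed.

Lemma ranking_vector_unique (p q : 'cV[R]_n) :
  ranking_vector P p -> ranking_vector P q -> p = q.
Proof.
case=> -[_ sp] pP [[_ sq] qP].
apply/eqP; rewrite -subr_eq0 -[p - q]trmxK -trmx0.
rewrite (@fixed_row_sum0 (p - q)^T) //.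
  by rewrite linearB /= mulmxBl pP qP.
under eq_bigr do rewrite !mxE.
by rewrite sumrB sp sq subrr.
Qed.

Lemma exists_ranking_vector : (0 < n)%N -> exists p, ranking_vector P p.
Proof.
move=> n_gt0; have [x x0 xP] := exists_fixed_row n_gt0.
(* [s] normalises the fixed row [|x|] to total one; it is nonzero because [x] is. *)
pose s := \sum_u `|x 0 u|.
have s_ge0 : 0 <= s by apply: sumr_ge0.
have s0 : s != 0.
  rewrite psumr_eq0 //; case/rV0Pn: x0 => u xu.
  by apply/allPn; exists u; rewrite ?mem_index_enum ?normr_eq0.
exists (s^-1 *: map_mx Num.norm x)^T; split; last first.
  by rewrite trmxK -scalemxAl fixed_normr.
split=> [u|]; first by rewrite !mxE mulr_ge0 ?invr_ge0.
under eq_bigr do rewrite !mxE.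
by rewrite -mulr_sumr mulVf.
Qed.

End StochasticMatrices.

(** * Stochasticity of the hyperlink matrix and of convex combinations *)

Lemma hyperlink_stochastic (R : realFieldType) (n : nat) (e : rel 'I_n) :
  (forall u, (1 <= #|out_nbrs e u|)%N) -> stochastic_mx (hyperlink_mx R e).
Proof.
move=> deg_gt0; split=> [u v|u].
  by rewrite mxE; case: ifP; rewrite ?invr_ge0 ?ler0n.
under eq_bigr do rewrite mxE.
rewrite -big_mkcond sumr_const -[RHS](@mulVf _ #|out_nbrs e u|%:R) ?mulr_natr //.
by rewrite pnatr_eq0 -lt0n.
Qed.

Lemma stochastic_convex (R : numDomainType) (n : nat) (S T : 'M[R]_n) (a b : R) :
  0 <= a -> 0 <= b -> a + b = 1 -> stochastic_mx S -> stochastic_mx T ->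
  stochastic_mx (a *: S + b *: T).
Proof.
move=> a0 b0 ab [S0 S1] [T0 T1]; split=> [u v|u].
  by rewrite !mxE addr_ge0 ?mulr_ge0.
under eq_bigr do rewrite !mxE.
by rewrite big_split -!mulr_sumr S1 T1 !mulr1.
Qed.

(** * Proximity matrix and connectivity from [W] *)

Section Proximity.
Variables (R : realFieldType) (n K : nat) (e : rel 'I_n).
Variable D : 'I_K -> {set 'I_n}.
Hypothesis D_dec : decomposition D.

Let D_triv : trivIset (blocks D).
Proof. by case: D_dec => _ /and3P[]. Qed.

Let mem_cover_blocks v : v \in cover (blocks D).
Proof. by case: D_dec => _ /cover_partition ->; rewrite inE. Qed.

Lemma mem_block_of v : v \in block_of D v.
Proof. by rewrite mem_pblock. Qed.

Lemma block_of_mem v B : B \in blocks D -> v \in B -> block_of D v = B.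
Proof. exact: def_pblock. Qed.

Lemma prox_blocks_sub u : prox_blocks e D u \subset blocks D.
Proof. by apply/subsetP => _ /imsetP[w _ ->]; apply: pblock_mem. Qed.

Lemma prox_setE u : prox_set e D u = cover (prox_blocks e D u).
Proof. by rewrite cover_imset. Qed.

Lemma card_prox_blocks_gt0 u : (0 < #|prox_blocks e D u|)%N.
Proof.
by apply/card_gt0P; exists (block_of D u); apply: imset_f; rewrite setU11.
Qed.

Lemma card_block_of_gt0 v : (0 < #|block_of D v|)%N.
Proof. by apply/card_gt0P; exists v; apply: mem_block_of. Qed.

Lemma prox_mx_gt0 u v : v \in prox_set e D u -> 0 < prox_mx R e D u v.
Proof.
move=> uv; rewrite mxE uv invr_gt0 mulr_gt0 // ltr0n.
  exact: card_prox_blocks_gt0.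
exact: card_block_of_gt0.
Qed.

(** The proximal set is a disjoint union of [N_u] blocks, and each block [B] contributes [|B|]
    entries [1 / (N_u |B|)], hence [1 / N_u]. *)
Lemma prox_stochastic : stochastic_mx (prox_mx R e D).
Proof.
split=> [u v|u]; first by rewrite mxE; case: ifP; rewrite ?invr_ge0 ?mulr_ge0.
under eq_bigr do rewrite mxE.
rewrite -big_mkcond prox_setE big_trivIset /=; last first.
  exact: trivIsetS (prox_blocks_sub u) D_triv.
rewrite (eq_bigr (fun=> #|prox_blocks e D u|%:R^-1)) => [|B uB].
  rewrite sumr_const -[RHS](@mulVf _ #|prox_blocks e D u|%:R) ?mulr_natr //.
  by rewrite pnatr_eq0 -lt0n card_prox_blocks_gt0.
rewrite (eq_bigr (fun=> (#|prox_blocks e D u|%:R * #|B|%:R)^-1)) => [|v vB].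
  rewrite sumr_const invfM -mulrnAr -[_ *+ #|B|]mulr_natr mulVf ?mulr1 //.
  case/imsetP: uB => w _ ->.
  by rewrite pnatr_eq0 -lt0n card_block_of_gt0.
by rewrite (block_of_mem (subsetP (prox_blocks_sub u) _ uB)).
Qed.

Lemma indicator_mx_ge0 k l : 0 <= indicator_mx R e D k l.
Proof.
rewrite mxE; apply: sumr_ge0 => i _; rewrite !mxE mulr_ge0 //; case: ifP => //.
by rewrite invr_ge0 mulr_ge0.
Qed.

(** The entry is the sum over the nodes [i] of [D k] of the entries [(i, l)] of [factor_R], so some
    term must be nonzero. *)
Lemma indicator_mx_gt0 k l : 0 < indicator_mx R e D k l ->
  exists2 i, i \in D k & D l \in prox_blocks e D i.
Proof.
rewrite mxE => W_gt0.
case: (pickP (fun i => (i \in D k) && (D l \in prox_blocks e D i))).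
  by move=> i /andP[]; exists i.
move=> W0; move: W_gt0; rewrite big1 ?ltxx // => i _; rewrite !mxE.
by have := W0 i; do 2!case: (_ \in _) => //=; rewrite ?mul0r ?mulr0.
Qed.

(** Induction on [m]: a positive entry of [W^(m+1)] has a positive term [W k j * W^m j l], and
    closure of [S] carries [D k] to [D j]. Working with a closed set avoids building explicit
    paths. *)
Lemma indicator_expr_reach (S : {set 'I_n}) :
  (forall u v, u \in S -> v \in prox_set e D u -> v \in S) ->
  forall m k l, 0 < (indicator_mx R e D ^+ m) k l ->
  D k \subset S -> D l \subset S.
Proof.
move=> S_closed; elim=> [|m IHm] k l.
  by rewrite expr0 mxE; case: eqVneq => [->|_]; rewrite ?ltxx.
rewrite exprS mxE => W_gt0 kS.
case: (pickP (fun j => 0 < indicator_mx R e D k j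
                       * (indicator_mx R e D ^+ m) j l)) => [j|W0]; last first.
  move: W_gt0; rewrite lt_neqAle => /andP[W_neq0 W_ge0].
  have W_le0 : \sum_j indicator_mx R e D k j * (indicator_mx R e D ^+ m) j l <= 0.
    by apply: sumr_le0 => j _; rewrite leNgt W0.
  by rewrite eq_le W_ge0 W_le0 in W_neq0.
(* The sign of [W k j] is needed to split the positive product into two positive factors. *)
have := indicator_mx_ge0 k j; rewrite le0r => /orP[/eqP->|Wkj].
  by rewrite mul0r ltxx.
rewrite pmulr_rgt0 // => /IHm; apply.
case: (indicator_mx_gt0 Wkj) => i ik ji; apply/subsetP => v vj.
apply: (S_closed i); first exact: (subsetP kS).
by rewrite prox_setE; apply/bigcupP; exists (D j).
Qed.

Hypothesis W_irr : irreducible_mx (indicator_mx R e D).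

Lemma connect_prox u v : connect (fun i j => j \in prox_set e D i) u v.
Proof.
have inD w : exists k, block_of D w = D k.
  by have /imsetP[k _ wk] := pblock_mem (mem_cover_blocks w); exists k.
have [[k uk] [l vl]] := (inD u, inD v).
pose S := [set w | connect (fun i j => j \in prox_set e D i) u w].
have S_closed i j : i \in S -> j \in prox_set e D i -> j \in S.
  by rewrite !inE => ui ij; apply: connect_trans ui (connect1 _).
(* The proximal set of [u] contains the whole block of [u]. *)
have kS : D k \subset S.
  apply/subsetP => w wk; apply: (S_closed u); first by rewrite inE connect0.
  by apply/bigcupP; exists u; rewrite ?setU11 // uk.
have [m _ W_gt0] := W_irr k l.
have := subsetP (indicator_expr_reach S_closed W_gt0 kS) v.
by rewrite inE; apply; rewrite -vl mem_block_of.
Qed.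

End Proximity.

Theorem corollary1 (R : realType) (n K : nat) (e : rel 'I_n)
    (D : 'I_K -> {set 'I_n}) (eta mu : R)
    (n_gt0 : (0 < n)%N)
    (out_edges : forall u : 'I_n, (1 <= #|out_nbrs e u|)%N)
    (D_partition : decomposition D)
    (eta_gt0 : 0 < eta) (mu_gt0 : 0 < mu) (eta_mu : eta + mu = 1)
    (W_irr : irreducible_mx (indicator_mx R e D)) :
  let P : 'M[R]_n := eta *: hyperlink_mx R e + mu *: prox_mx R e D in
  (exists! p : 'cV[R]_n, ranking_vector P p) /\
  (forall p : 'cV[R]_n, ranking_vector P p -> forall u : 'I_n, 0 < p u 0).
Proof.
move=> P.
have H_stoch := @hyperlink_stochastic R n e out_edges.
have P_stoch : stochastic_mx P.
  by apply: stochastic_convex; rewrite ?ltW //; apply: prox_stochastic.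
have P_conn u v : connect (support_rel P) u v.
  apply: connect_sub (connect_prox D_partition W_irr u v) => i j ij.
  (* Adding the non-negative [eta *: H] keeps the positive entries of [mu *: M] positive. *)
  apply: connect1; rewrite /support_rel [P i j]mxE [X in X + _]mxE [X in _ + X]mxE.
  apply: ltr_wpDl; first by apply: mulr_ge0 (ltW eta_gt0) (H_stoch.1 i j).
  by rewrite mulr_gt0 // prox_mx_gt0.
split; last by move=> p; apply: ranking_vector_gt0.
have [p pP] := exists_ranking_vector P_stoch n_gt0.
exists p; split=> // q; exact: ranking_vector_unique.
Qed.
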